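(* For every integer $d\ge 2$, $$\frac{d}{d+1}\le\frac{\sigma_{d+1}}{\sigma_d},$$ where, for an integer $n\ge 2$, $$\sigma_n=\frac{2}{\pi}\int_0^\infty\left(\frac{\sin t}{t}\right)^n\,dt .$$ *)

(* Defs.v *)
From mathcomp Require Import all_boot all_order all_algebra.
From mathcomp Require Import all_classical all_reals all_analysis.

Set Implicit Arguments.
Unset Strict Implicit.
Unset Printing Implicit Defensive.

Import Order.TTheory GRing.Theory Num.Theory.

Local Open Scope classical_set_scope.
Local Open Scope ring_scope.

(* Meaningful for n >= 2, where the integrand is Lebesgue integrable on
   [0, +oo[; for n <= 1 the integral is infinite or
   undefined and [Rintegral] returns a junk value. At t = 0 the quotient [sin t / t] evaluates
   to 0 rather than 1; this changes the integrand on a null set only. *)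
Definition sigma (R : realType) (n : nat) : R :=
  2 / pi *
  \int[@lebesgue_measure R]_(t in `[0, +oo[) (sin t / t) ^+ n.

(* Main.v *)
Require Import Defs.
From mathcomp Require Import all_boot all_order all_algebra ring lra zify.
From mathcomp Require Import all_classical all_reals all_analysis.
From mathcomp Require Import measurable_realfun.

(** Write [F_n x = \int_0^oo (sin t / t)^n cos (x t) dt], called [cosint n x]
    below, so that [sigma_n = 2 / pi * F_n 0]. Up to a constant, [F_n] is the
    density of a sum of [n] independent uniform variables on [[-1, 1]]; the
    proof uses the shape of this density, derived from the integral alone.

    - For [n >= 2], [F_{n+1}' x = (F_n (x + 1) - F_n (x - 1)) / 2]
      ([is_derive_cosint]), while [F_2 x] is an explicit tent function
      ([cosint2]).
    - Hence [F_n x] is nonincreasing in [|x|] ([cosint_le]): inductively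
      [F_{n+1}' x <= 0] for [x >= 0], because [|x - 1| <= |x + 1|].
    - Hence [F_{n+1}] is concave on [[0, 1]], where [F_n (x + 1)] decreases and
      [F_n (x - 1)] increases; and [F_2] is affine there. So every [F_n] lies
      above its chord on [[0, 1]] ([cosint_chord]).
    - [F_{n+1} 0] is the integral of [F_n] over [[0, 1]], so that
      [F_{n+1} 0 >= (F_n 0 + F_n 1) / 2] ([cosint_trapezoid]).
    - [n F_{n+1} 0 = (n + 1) F_n 1] ([cosint1]). This eliminates [F_n 1] and
      leaves [F_{n+1} 0 >= (n + 1) / (n + 2) * F_n 0] ([cosint_ratio]).

    As [d / (d + 1) <= (d + 1) / (d + 2)], the claim follows.

    The analytic tools are differentiation under the integral sign, with
    dominating functions that are multiples of [1 / (1 + t^2)], and the change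
    of variables [t := a t], which supplies both [cosint2] and [cosint1]. All
    integrals are taken over the open half-line, so that [t] can be cancelled
    in quotients. *)

Set Implicit Arguments.
Unset Strict Implicit.
Unset Printing Implicit Defensive.

Import Order.TTheory GRing.Theory Num.Theory numFieldNormedType.Exports.

Local Open Scope ring_scope.

Section CosineTransform.
Local Open Scope classical_set_scope.
Context {R : realType}.
Local Notation mu := (@lebesgue_measure R).
Local Notation halfline := (`]0%R, +oo[%classic : set R).

(** * Change of scale on the half-line *)

(** Lebesgue measure is the only measure with the right values on intervals,
    so it equals [r] times its image under multiplication by [r]. *)
Lemma ge0_integral_scale (r : R) (f : R -> \bar R) : 0 < r ->
  measurable_fun halfline f -> (forall x, halfline x -> 0 <= f x)%E ->
  (\int[mu]_(x in halfline) f x = r%:E * \int[mu]_(x in halfline) f (r * x)%R)%E.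
Proof.
move=> r0 mf f0.
have mphi : measurable_fun [set: measurableTypeR R] (fun x => r * x : measurableTypeR R).
  exact: measurable_funM.
have @pf : {measure set (measurableTypeR R) -> \bar R}.
  by refine (pushforward mu (fun x : measurableTypeR R => r * x : measurableTypeR R)).
have r0' : 0 <= r := ltW r0.
pose k : {nonneg R} := NngNum r0'.
have E A : measurable A -> mu A = mscale k pf A.
  apply: lebesgue_measure_unique => //= _ [[a b]] _ <-.
  rewrite /mscale/= /pf /pushforward /=.
  have -> : (fun x => r * x) @^-1` `]a, b] = `]r^-1 * a, r^-1 * b]%classic :> set R.
    apply/seteqP; split => x /=; rewrite !in_itv/= ltr_pdivrMl// ler_pdivlMl//.
  rewrite !lebesgue_measure_itv/= !lte_fin ltr_pM2l ?invr_gt0//.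
  case: ifP => // _; rewrite ?mule0 // -!EFinD -EFinM; congr EFin.
  by rewrite mulrBr !mulrA mulfV ?gt_eqF// !mul1r.
have -> : (\int[mu]_(x in halfline) f x = \int[mscale k pf]_(x in halfline) f x)%E.
  by apply: eq_measure_integral => A mA _; exact: E.
rewrite ge0_integral_mscale//; congr (_ * _)%E.
rewrite /pf ge0_integral_pushforward//; last by move=> x; rewrite inE; exact: f0.
congr (integral _ _ _).
by apply/seteqP; split => x /=; rewrite !in_itv/= !andbT pmulr_rgt0.
Qed.

Lemma Rintegral_scale (r : R) (f : R -> R) : 0 < r ->
  mu.-integrable halfline (EFin \o f) ->
  \int[mu]_(x in halfline) f x = r * \int[mu]_(x in halfline) f (r * x).
Proof.
move=> r0 intf; rewrite /Rintegral.
have mf := measurable_int _ intf.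
have mD : measurable (halfline : set (measurableTypeR R)) by [].
have pfin := @integrable_pos_fin_num _ _ _ mu _ mD _ intf.
have nfin := @integrable_neg_fin_num _ _ _ mu _ mD _ intf.
have sp := ge0_integral_scale r0 (measurable_funepos mf) (fun x _ => funepos_ge0 _ x).
have sn := ge0_integral_scale r0 (measurable_funeneg mf) (fun x _ => funeneg_ge0 _ x).
have H x : (r%:E * x)%E \is a fin_num -> exists y, x = y%:E.
  by case: x => [y||]; [exists y|rewrite gt0_muley ?lte_fin|rewrite gt0_muleNy ?lte_fin].
rewrite integralE [in RHS]integralE.
move: pfin nfin; rewrite sp sn => /H[a pa] /H[b nb].
transitivity (fine (r%:E * a%:E - r%:E * b%:E)).
  by congr (fine (_ - _)); rewrite -?pa -?nb.
rewrite /= -mulrBr; congr (_ * _); rewrite -[LHS]/(fine (a%:E - b%:E)).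
by congr (fine (_ - _)); rewrite -?pa -?nb; apply: eq_integral => x _;
  rewrite ?funeposE ?funenegE.
Qed.

(** * Integrability on the half-line *)

Lemma measurable_invr : measurable_fun halfline (fun t => t^-1).
Proof.
apply: open_continuous_measurable_fun; first exact: interval_open.
move=> x; rewrite inE/= in_itv/= andbT => x0; apply: cvgV => //; exact: lt0r_neq0.
Qed.

Lemma continuous_measurable_halfline (f : R -> R) : continuous f ->
  measurable_fun halfline f.
Proof.
move=> cf; apply: (@measurable_funS _ _ _ _ setT) => //.
exact: continuous_measurable_fun.
Qed.

Lemma measurable_sin_scale a : measurable_fun halfline (fun t => sin (a * t)).
Proof.
apply: continuous_measurable_halfline => t.
apply: continuous_comp; [exact: mulrl_continuous|exact: continuous_sin].
Qed.

Lemma measurable_cos_scale a : measurable_fun halfline (fun t => cos (a * t)).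
Proof.
apply: continuous_measurable_halfline => t.
apply: continuous_comp; [exact: mulrl_continuous|exact: continuous_cos].
Qed.

Lemma norm_sin_le (x : R) : `|sin x| <= `|x|.
Proof.
wlog x0 : x / 0 <= x.
  move=> H; have [/H//|/ltW] := leP 0 x.
  by rewrite -oppr_ge0 => /H; rewrite sinN !normrN.
have [c _] := @MVT_segment R sin cos 0 x x0 (fun y _ => is_derive_sin y)
  (continuous_subspaceT (@continuous_sin R)).
rewrite sin0 !subr0 => ->; rewrite normrM ler_piMl//; exact: cos_max.
Qed.

Lemma integrable_oneDsqrV : mu.-integrable halfline (fun t => (oneDsqr t)^-1%:E).
Proof.
have mq : measurable_fun halfline (fun t : R => (oneDsqr t)^-1%:E).
  apply/measurable_EFinP; apply: continuous_measurable_halfline.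
  exact: continuous_oneDsqrV.
apply/integrableP; split; first exact: mq.
rewrite [ltLHS](_ : _ = \int[mu]_(x in halfline) (oneDsqr x)^-1%:E)%E; last first.
  by apply: eq_integral => x _; rewrite gee0_abs// lee_fin invr_ge0.
by rewrite integral_itv_obnd_cbnd// integral0y_oneDsqr ltry.
Qed.

Lemma integrable_le_oneDsqrV (f : R -> R) (C : R) : measurable_fun halfline f ->
  (forall t, 0 < t -> `|f t| <= C * (oneDsqr t)^-1) ->
  mu.-integrable halfline (EFin \o f).
Proof.
move=> mf fC.
apply: (@le_integrable _ _ _ mu halfline (measurable_itv _) _
  (fun t => C%:E * (oneDsqr t)^-1%:E)%E).
- exact/measurable_EFinP.
- move=> t /=; rewrite in_itv/= andbT => t0.
  by rewrite lee_fin (le_trans (fC _ t0))// ler_norm.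
- exact: integrableZl integrable_oneDsqrV.
Qed.

(** With [s = |sin (a t) / t|] one has [s <= A] and [s t <= 1], hence
    [s^2 (1 + t^2) <= A^2 + 1]; the remaining [n] factors are at most [A]. The
    uniformity in [a] is what allows differentiation with respect to [a]. *)
Lemma sin_ratio_bound (a A t : R) n : `|a| <= A -> 0 < t ->
  `|(sin (a * t) / t) ^+ n.+2| <= (A ^+ 2 + 1) * A ^+ n * (oneDsqr t)^-1.
Proof.
move=> aA t0.
have s1 : `|sin (a * t) / t| <= A.
  rewrite normrM normfV (gtr0_norm t0) ler_pdivrMr// (le_trans (norm_sin_le _))//.
  by rewrite normrM (gtr0_norm t0) ler_pM2r.
have s2 : `|sin (a * t) / t| * t <= 1.
  by rewrite normrM normfV (gtr0_norm t0) divfK ?gt_eqF// sin_max.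
have A0 : 0 <= A by exact: le_trans aA.
pose s : R := `|sin (a * t) / t|; have s0 : 0 <= s by exact: normr_ge0.
rewrite -/s in s1 s2.
have sq : s ^+ 2 <= (A ^+ 2 + 1) * (oneDsqr t)^-1.
  rewrite ler_pdivlMr ?(lt_le_trans ltr01 (oneDsqr_ge1 _))//.
  rewrite /oneDsqr mulrDr mulr1 -exprMn.
  have ss : 0 <= s * t by rewrite mulr_ge0// ltW.
  by apply: lerD; [apply: lerXn2r; rewrite ?nnegrE|rewrite expr_le1].
have sn : s ^+ n <= A ^+ n by apply: lerXn2r; rewrite ?nnegrE.
rewrite normrX -/s -[n.+2]/(2 + n)%N exprD [leRHS]mulrAC.
by apply: ler_pM; rewrite ?exprn_ge0.
Qed.

(** Differentiation under the integral sign, in the form used throughout: the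
    dominating function is always a multiple of [1 / (1 + t^2)]. *)
Lemma is_derive_integral (f f' : R -> R -> R) (u v a C : R) : u < a < v ->
  (forall x, u < x < v -> mu.-integrable halfline (EFin \o f x)) ->
  (forall x t, u < x < v -> 0 < t -> is_derive x 1 (f ^~ t) (f' x t)) ->
  (forall x t, u < x < v -> 0 < t -> `|f' x t| <= C * (oneDsqr t)^-1) ->
  is_derive a 1 (fun x => \int[mu]_(t in halfline) f x t)
    (\int[mu]_(t in halfline) f' a t).
Proof.
move=> uav intf df f'C.
have Ia : `]u, v[%classic a by rewrite /= in_itv.
have mD : measurable (halfline : set (measurableTypeR R)) by [].
have I x : `]u, v[%classic x -> u < x < v by rewrite /= in_itv.
have T t : halfline t -> 0 < t by rewrite /= in_itv/= andbT.
have intf' x : `]u, v[%classic x -> mu.-integrable halfline (EFin \o f x).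
  by move=> /I; exact: intf.
have derf x t : `]u, v[%classic x -> halfline t -> derivable (f ^~ t) x 1.
  by move=> /I ux /T t0; have [] := df _ _ ux t0.
have f'E x t : u < x < v -> 0 < t -> partial1of2 f x t = f' x t.
  by move=> ux t0; rewrite partial1of2E; have [_ ->] := df _ _ ux t0.
pose G (t : R) := `|C| * (oneDsqr t)^-1.
have G0 t : 0 <= G t.
  by rewrite mulr_ge0// invr_ge0 (le_trans ler01 (oneDsqr_ge1 _)).
have intG : mu.-integrable halfline (EFin \o G).
  apply: (@integrable_le_oneDsqrV _ `|C|) => [|t t0].
    apply: continuous_measurable_halfline => t.
    by apply: cvgM; [exact: cvg_cst|exact: continuous_oneDsqrV].
  by rewrite ger0_norm.
have ubG x t : `]u, v[%classic x -> halfline t -> `|partial1of2 f x t| <= G t.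
  move=> /I ux /T t0; rewrite f'E// (le_trans (f'C _ _ ux t0))//.
  by rewrite ler_wpM2r ?ler_norm// invr_ge0 (le_trans ler01 (oneDsqr_ge1 _)).
split; first exact: (derivable_under_integral mD Ia intf' derf G0 intG ubG).
rewrite -derive1E (differentiation_under_integral mD Ia intf' derf G0 intG ubG).
by apply: eq_Rintegral => t; rewrite inE => /T t0; exact: f'E.
Qed.

(** * The cosine transform of a power of the sinc function *)

Definition cosint (n : nat) (x : R) : R :=
  \int[mu]_(t in halfline) ((sin t / t) ^+ n * cos (x * t)).

Lemma measurable_sin_ratio a n :
  measurable_fun halfline (fun t : R => (sin (a * t) / t) ^+ n).
Proof.
apply: measurable_funX; apply: measurable_funM; last exact: measurable_invr.
exact: measurable_sin_scale.
Qed.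

Lemma integrable_sin_ratio a n :
  mu.-integrable halfline (EFin \o (fun t : R => (sin (a * t) / t) ^+ n.+2)).
Proof.
apply: integrable_le_oneDsqrV; first exact: measurable_sin_ratio.
by move=> t t0; exact: (@sin_ratio_bound a `|a|).
Qed.

Lemma sinc_bound (t y B : R) n : 0 < t -> `|y| <= B ->
  `|(sin t / t) ^+ n.+2 * y| <= 2 * B * (oneDsqr t)^-1.
Proof.
move=> t0 yB; rewrite normrM mulrAC; apply: ler_pM => //.
have := @sin_ratio_bound 1 1 t n; rewrite mul1r expr1n expr1n mulr1 normr1 -[1 + 1]/2.
exact.
Qed.

Lemma integrable_sinc_mul n (g : R -> R) (B : R) : measurable_fun halfline g ->
  (forall t, 0 < t -> `|g t| <= B) ->
  mu.-integrable halfline (EFin \o (fun t => (sin t / t) ^+ n.+2 * g t)).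
Proof.
move=> mg gB; apply: (@integrable_le_oneDsqrV _ (2 * B)) => [|t t0].
  apply: measurable_funM => //.
  have := measurable_sin_ratio 1 n.+2.
  by under [X in measurable_fun _ X -> _]eq_fun do rewrite mul1r.
by apply: sinc_bound => //; exact: gB.
Qed.

Lemma integrable_cosint n x :
  mu.-integrable halfline (EFin \o (fun t => (sin t / t) ^+ n.+2 * cos (x * t))).
Proof.
apply: (@integrable_sinc_mul _ _ 1) => [|t _]; last exact: cos_max.
exact: measurable_cos_scale.
Qed.

Lemma cosint0 n : cosint n 0 = \int[mu]_(t in halfline) (sin t / t) ^+ n.
Proof. by apply: eq_Rintegral => t _; rewrite mul0r cos0 mulr1. Qed.

Lemma sigma_cosint n : sigma R n.+2 = 2 / pi * cosint n.+2 0.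
Proof.
rewrite /sigma cosint0 Rintegral_itv_obnd_cbnd//.
have := integrable_sin_ratio 1 n.
by under [X in _.-integrable _ X -> _]eq_fun do rewrite /= mul1r.
Qed.

Lemma cosintN n x : cosint n (- x) = cosint n x.
Proof. by apply: eq_Rintegral => t _; rewrite mulNr cosN. Qed.

(** The derivative of [cos (x t)] brings out a factor [t], which cancels one
    denominator of [(sin t / t)^n]; then
    [- 2 sin t sin (x t) = cos ((x + 1) t) - cos ((x - 1) t)]. *)
Lemma is_derive_cosint n (x : R) :
  is_derive x 1 (cosint n.+3) ((cosint n.+2 (x + 1) - cosint n.+2 (x - 1)) / 2).
Proof.
pose f (x t : R) := (sin t / t) ^+ n.+3 * cos (x * t).
pose f' (x t : R) := (sin t / t) ^+ n.+2 * ((cos ((x + 1) * t) - cos ((x - 1) * t)) / 2).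
have mD : measurable (halfline : set (measurableTypeR R)) by [].
have -> : (cosint n.+2 (x + 1) - cosint n.+2 (x - 1)) / 2 =
    \int[mu]_(t in halfline) f' x t.
  rewrite /cosint -RintegralB//; try exact: integrable_cosint.
  rewrite -RintegralZr//; last first.
    exact: (integrableB mD (integrable_cosint n (x + 1)) (integrable_cosint n (x - 1))).
  by apply: eq_Rintegral => t _; rewrite /f' -mulrBr mulrA.
apply: (@is_derive_integral f f' (x - 1) (x + 1) x (2 * 1)).
- by rewrite ltrBlDr ltrDl ltr01.
- by move=> y _; exact: integrable_cosint.
- move=> y t _ t0; rewrite /f.
  apply: is_derive_eq.
  rewrite scaler0 add0r /GRing.scale/= mulr1 /f'.
  rewrite [(y + 1) * t]mulrDl [(y - 1) * t]mulrBl mul1r !cosD cosN sinN !exprSr.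
  by field; rewrite gt_eqF.
- move=> y t _ t0; apply: sinc_bound => //.
  rewrite /= normrM (ger0_norm (_ : 0 <= 2^-1)) ?invr_ge0//.
  rewrite ler_pdivrMr// mul1r (le_trans (ler_normB _ _))//.
  by rewrite -[2]/(1 + 1) lerD// cos_max.
Qed.

(** This gives a primitive of [cosint n.+2] that vanishes at [0] and takes the
    value [cosint n.+3 0] at [1]. *)
Lemma is_derive_sin_transform n (x : R) :
  is_derive x 1 (fun x => \int[mu]_(t in halfline) ((sin t / t) ^+ n.+2 * (sin (x * t) / t)))
    (cosint n.+2 x).
Proof.
apply: (@is_derive_integral _ (fun x t => (sin t / t) ^+ n.+2 * cos (x * t))
  (x - 1) (x + 1) x (2 * 1)).
- by rewrite ltrBlDr ltrDl ltr01.
- move=> y _; apply: (@integrable_sinc_mul _ _ `|y|) => [|t t0].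
    apply: measurable_funM; last exact: measurable_invr.
    exact: measurable_sin_scale.
  rewrite normrM normfV (gtr0_norm t0) ler_pdivrMr// (le_trans (norm_sin_le _))//.
  by rewrite normrM (gtr0_norm t0).
- move=> y t _ t0.
  apply: is_derive_eq.
  rewrite scaler0 add0r /GRing.scale/= mulr1.
  by field; rewrite gt_eqF.
- by move=> y t _ t0; apply: sinc_bound => //; exact: cos_max.
Qed.

(** * Two consequences of scaling *)

Lemma sin_ratio_scale n a : 0 < a ->
  \int[mu]_(t in halfline) (sin (a * t) / t) ^+ n.+2 = a ^+ n.+1 * cosint n.+2 0.
Proof.
move=> a0; rewrite cosint0.
have intf : mu.-integrable halfline (EFin \o (fun t : R => (sin t / t) ^+ n.+2)).
  have := integrable_sin_ratio 1 n.
  by under [X in _.-integrable _ X -> _]eq_fun do rewrite /= mul1r.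
have mD : measurable (halfline : set (measurableTypeR R)) by [].
rewrite (Rintegral_scale a0 intf) mulrA -exprSr -RintegralZl//; last first.
  have := integrable_sin_ratio a n.
  move/(integrableZl mD (a^-1 ^+ n.+2)).
  apply: eq_integrable => // t; rewrite inE/= in_itv/= andbT => t0.
  rewrite -EFinM -exprMn; congr (_ ^+ _)%:E.
  by field; rewrite !gt_eqF.
apply: eq_Rintegral => t; rewrite inE/= in_itv/= andbT => t0.
by rewrite -exprMn; congr (_ ^+ _); field; rewrite !gt_eqF.
Qed.

(** By scaling, [\int (sin (a t) / t)^(n+3) dt = a^(n+2) F_{n+3} 0]. Both sides
    are differentiated with respect to [a] at [a = 1]. *)
Lemma cosint1 n : n.+2%:R * cosint n.+3 0 = n.+3%:R * cosint n.+2 1.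
Proof.
have d1 : is_derive (1 : R) 1 (fun a => \int[mu]_(t in halfline) (sin (a * t) / t) ^+ n.+3)
    (\int[mu]_(t in halfline) (n.+3%:R * ((sin (1 * t) / t) ^+ n.+2 * cos (1 * t)))).
  apply: (@is_derive_integral _
    (fun a t => n.+3%:R * ((sin (a * t) / t) ^+ n.+2 * cos (a * t))) 0 2 1
    (n.+3%:R * ((2 ^+ 2 + 1) * 2 ^+ n))).
  - by rewrite ltr01 ltr1n.
  - by move=> a _; exact: integrable_sin_ratio.
  - move=> a t _ t0.
    have dF : is_derive a 1 (fun a => sin (a * t) / t) (cos (a * t)).
      apply: is_derive_eq.
      by rewrite scaler0 add0r /GRing.scale/= mulr1; field; rewrite gt_eqF.
    have := is_deriveX n.+3 dF; rewrite exprfctE => dX.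
    by apply: is_derive_eq; rewrite /GRing.scale/= mulrA.
  - move=> a t /andP[a0 a2] t0.
    rewrite normrM normr_nat -mulrA ler_wpM2l// normrM.
    rewrite -[leRHS]mulr1 ler_pM ?cos_max// sin_ratio_bound//.
    by rewrite ger0_norm ltW.
have d2 : is_derive (1 : R) 1 (fun a => \int[mu]_(t in halfline) (sin (a * t) / t) ^+ n.+3)
    (n.+2%:R * cosint n.+3 0).
  apply: (@near_eq_is_derive _ _ _ (fun a : R => a ^+ n.+2 * cosint n.+3 0)).
    near=> a; rewrite sin_ratio_scale//; near: a; exact: lt_nbhsr.
  have := is_deriveX n.+2 (is_derive_id (1 : R) 1); rewrite exprfctE => dX.
  by apply: is_derive_eq; rewrite scaler0 add0r expr1n /GRing.scale/= !mulr1 mulrC.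
have [_ <-] := d2; have [_ ->] := d1.
have mD : measurable (halfline : set (measurableTypeR R)) by [].
rewrite /cosint -RintegralZl//; last exact: integrable_cosint.
by apply: eq_Rintegral => t _; rewrite !mul1r.
Unshelve. all: by end_near.
Qed.

(** Allowing [a <= 0] here spares a distinction of cases in [cosint2]. *)
Lemma sin_sqr_ratio a :
  \int[mu]_(t in halfline) (sin (a * t) / t) ^+ 2 = `|a| * cosint 2 0.
Proof.
have [a0|a0|<-] := ltgtP 0 a.
- by rewrite sin_ratio_scale// gtr0_norm// expr1.
- rewrite ltr0_norm// -[- a]expr1 -sin_ratio_scale ?oppr_gt0//.
  by apply: eq_Rintegral => t _; rewrite mulNr sinN mulNr sqrrN.
- rewrite normr0 mul0r /Rintegral integral0_eq// => t _.
  by rewrite mul0r sin0 mul0r expr0n.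
Qed.

(** Since [2 sin^2 t cos (x t)] equals
    [sin^2 ((1 + x/2) t) + sin^2 ((1 - x/2) t) - 2 sin^2 (x t / 2)], the
    integral reduces to three scaled copies of [\int (sin t / t)^2 dt]. *)
Lemma cosint2 x :
  cosint 2 x = cosint 2 0 * (`|1 + x / 2| + `|1 - x / 2| - `|x|) / 2.
Proof.
have mD : measurable (halfline : set (measurableTypeR R)) by [].
transitivity ((\int[mu]_(t in halfline) (sin ((1 + x / 2) * t) / t) ^+ 2 +
  \int[mu]_(t in halfline) (sin ((1 - x / 2) * t) / t) ^+ 2 -
  (\int[mu]_(t in halfline) (sin (x / 2 * t) / t) ^+ 2 +
   \int[mu]_(t in halfline) (sin (x / 2 * t) / t) ^+ 2)) / 2); last first.
  by rewrite !sin_sqr_ratio normrM (ger0_norm (_ : 0 <= 2^-1)) ?invr_ge0//; field.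
have I a := integrable_sin_ratio a 0.
have I1 := integrableD mD (I (1 + x / 2)) (I (1 - x / 2)).
have I2 := integrableD mD (I (x / 2)) (I (x / 2)).
rewrite -!RintegralD// -RintegralB// -RintegralZr//; last exact: (integrableB mD I1 I2).
apply: eq_Rintegral => t _.
rewrite [(1 + x / 2) * t]mulrDl [(1 - x / 2) * t]mulrBl mul1r.
have -> : x * t = x / 2 * t + x / 2 * t by field.
set y := x / 2 * t.
have Ct : cos t ^+ 2 = 1 - sin t ^+ 2 by exact: cos2sin2.
have Cy : cos y ^+ 2 = 1 - sin y ^+ 2 by exact: cos2sin2.
rewrite !sinD sinN cosN cosD.
rewrite !expr_div_n; move: (t ^+ 2)^-1 => T.
transitivity ((sin t ^+ 2 * cos y ^+ 2 + cos t ^+ 2 * sin y ^+ 2 - sin y ^+ 2) * T).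
  rewrite Ct -[cos y * cos y]expr2 Cy; ring.
by field.
Qed.

Lemma cosint_continuous n x : {for x, continuous (cosint n.+3)}.
Proof.
apply: differentiable_continuous; apply/derivable1_diffP.
by have [] := is_derive_cosint n x.
Qed.

(** On [(0, 1]] the mean value theorem gives [sin t / t = cos c >= cos 1]. *)
Lemma cosint2_gt0 : 0 < cosint 2 0.
Proof.
have mD : measurable (halfline : set (measurableTypeR R)) by [].
have mI : measurable (`]0, 1]%classic : set (measurableTypeR R)) by [].
have intf := integrable_sin_ratio 1 0.
have mf := measurable_int _ intf.
have sI : `]0%R, 1%R]%classic `<=` halfline by move=> t /=; rewrite !in_itv/= => /andP[->].
pose f (t : R) := (sin (1 * t) / t) ^+ 2.
have fge t : 0 < t <= 1 -> cos 1 ^+ 2 <= f t.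
  move=> /andP[t0 t1]; rewrite /f mul1r.
  have [c] := @MVT_segment R sin cos 0 t (ltW t0) (fun y _ => is_derive_sin y)
    (continuous_subspaceT (@continuous_sin R)).
  rewrite in_itv/= => /andP[c0 ct]; rewrite sin0 !subr0 => ->.
  have pi1 : 1 <= pi :> R by rewrite (le_trans _ (pi_ge2 R))// ler1n.
  rewrite mulfK ?gt_eqF//; apply: lerXn2r; rewrite ?nnegrE.
  - exact: ltW (cos1_gt0 R).
  - by apply: le_trans (ltW (cos1_gt0 R)) _; rewrite leNgt ltr_cos ?in_itv/=; lra.
  - by rewrite leNgt ltr_cos ?in_itv/=; lra.
have -> : cosint 2 0 = \int[mu]_(t in halfline) f t.
  by rewrite cosint0; apply: eq_Rintegral => t _; rewrite /f mul1r.
rewrite -lte_fin /Rintegral fineK; last exact: (integrable_fin_num mD intf).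
apply: (@lt_le_trans _ _ (\int[mu]_(t in `]0%R, 1%R]) (cos 1 ^+ 2)%:E)%E).
  rewrite integral_cst//= lebesgue_measure_itv/= lte_fin ltr01 oppr0 adde0 mule1.
  by rewrite lte_fin exprn_gt0// cos1_gt0.
apply: (@le_trans _ _ (\int[mu]_(t in `]0%R, 1%R]) (f t)%:E)%E).
  apply: ge0_le_integral => //.
  - by move=> t _; rewrite lee_fin exprn_even_ge0.
  - exact: measurable_funS mD sI mf.
apply: (@ge0_subset_integral _ _ _ mu _ _ mI mD (EFin \o f) mf _ sI).
by move=> t _; rewrite lee_fin exprn_even_ge0.
Qed.

(** * Monotonicity, concavity and the trapezoidal bound *)

(** Induction on [n]: for [x >= 0] the derivative
    [(cosint n.+2 (x + 1) - cosint n.+2 (x - 1)) / 2] of [cosint n.+3] is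
    nonpositive because [|x - 1| <= |x + 1|]. *)
Lemma cosint_le n x y : `|x| <= `|y| -> cosint n.+2 y <= cosint n.+2 x.
Proof.
have normE k z : cosint k z = cosint k `|z|.
  by case: (ger0P z) => // _; rewrite cosintN.
elim: n x y => [|n IH] x y xy; rewrite normE [leRHS]normE.
  rewrite !(cosint2 `|_|) ler_pM2r// ler_pM2l ?cosint2_gt0//.
  have y0 : 0 <= `|y| by exact: normr_ge0.
  have x0 : 0 <= `|x| by exact: normr_ge0.
  move: `|x| `|y| x0 y0 xy => a b a0 b0 ab.
  rewrite (ger0_norm a0) (ger0_norm b0) (ger0_norm (_ : 0 <= 1 + a / 2)); last by lra.
  rewrite (ger0_norm (_ : 0 <= 1 + b / 2)); last by lra.
  by case: (ger0P (1 - a / 2)); case: (ger0P (1 - b / 2)); lra.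
have [c c0 E] := @MVT_segment R (cosint n.+3) _ `|x| `|y| xy (fun z _ => is_derive_cosint n z)
  (continuous_subspaceT (@cosint_continuous n)).
rewrite -subr_le0 E mulr_le0_ge0 ?subr_ge0// pmulr_lle0// subr_le0 IH//.
have {c0} : 0 <= c by move: c0; rewrite in_itv/= => /andP[+ _]; exact: le_trans.
move=> c0; rewrite [leRHS]ger0_norm ?addr_ge0// ler_norml; apply/andP; split; lra.
Qed.

(** On [[0, 1]] the derivative of [cosint n.+3] is nonincreasing by [cosint_le];
    comparing its mean values on [[0, x]] and [[x, 1]] gives the chord
    inequality. The base case is the affine part of the tent [cosint2]. *)
Lemma cosint_chord n x : 0 <= x <= 1 ->
  cosint n.+2 0 + x * (cosint n.+2 1 - cosint n.+2 0) <= cosint n.+2 x.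
Proof.
case: n => [|n] /andP[x0 x1].
  rewrite !(cosint2 x) (cosint2 1); set c := cosint 2 0.
  rewrite !ger0_norm; lra.
have cs := continuous_subspaceT (@cosint_continuous n).
have [a a01 Ea] := @MVT_segment R (cosint n.+3) _ 0 x x0 (fun z _ => is_derive_cosint n z) (cs _).
have [b b01 Eb] := @MVT_segment R (cosint n.+3) _ x 1 x1 (fun z _ => is_derive_cosint n z) (cs _).
move: a01 b01 Ea Eb; rewrite !in_itv/= => /andP[a0 ax] /andP[xb b1].
set da := (X in _ = X * _ -> _); set db := (X in _ -> _ = X * _ -> _).
move=> Ea Eb.
have dab : db <= da.
  rewrite /da /db ler_pM2r// lerB// cosint_le//.
    by rewrite !ger0_norm; lra.
  by rewrite !ler0_norm; lra.
have : 0 <= x * (1 - x) * (da - db) by rewrite !mulr_ge0 ?subr_ge0.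
set u := cosint _ 0 in Ea Eb *; set v := cosint _ 1 in Ea Eb *; set w := cosint _ x in Ea Eb *.
have -> : v = w + db * (1 - x) by lra.
have -> : u = w - da * x by lra.
nra.
Qed.

(** The chord inequality of [cosint_chord] is integrated over [[0, 1]]: [D] is a
    primitive of the gap between the function and its chord. *)
Lemma cosint_trapezoid n : (cosint n.+2 0 + cosint n.+2 1) / 2 <= cosint n.+3 0.
Proof.
pose K x := \int[mu]_(t in halfline) ((sin t / t) ^+ n.+2 * (sin (x * t) / t)).
pose p := cosint n.+2 0; pose q := cosint n.+2 1.
pose D (x : R) := K x - (x * p + x ^+ 2 * ((q - p) / 2)).
have dD (x : R) : is_derive x 1 D (cosint n.+2 x - (p + x * (q - p))).
  have dK := is_derive_sin_transform n x.
  by apply: is_derive_eq; rewrite !scaler0 !add0r /GRing.scale/= !mulr1; field.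
have cD : continuous D.
  move=> x; apply: differentiable_continuous; apply/derivable1_diffP.
  by have [] := dD x.
have [c] := @MVT_segment R D _ 0 1 ler01 (fun z _ => dD z) (continuous_subspaceT cD).
rewrite in_itv/= => c01 E.
have : 0 <= D 1 - D 0.
  by rewrite E subr0 mulr1 subr_ge0; exact: cosint_chord.
have -> : D 1 = cosint n.+3 0 - (p + q) / 2.
  rewrite /D cosint0; congr (_ - _); last by field.
  by apply: eq_Rintegral => t _; rewrite mul1r -exprSr.
have -> : D 0 = 0.
  have -> : D 0 = K 0 by rewrite /D mul0r expr0n mul0r addr0 subr0.
  by rewrite /K /Rintegral integral0_eq// => t _; rewrite mul0r sin0 mul0r mulr0.
by rewrite subr0 subr_ge0.
Qed.

Lemma cosint_ratio n : n.+3%:R / n.+4%:R * cosint n.+2 0 <= cosint n.+3 0.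
Proof.
have := cosint_trapezoid n; have := cosint1 n.
set a := cosint n.+3 0; set p := cosint n.+2 0; set q := cosint n.+2 1.
move=> E H; rewrite mulrAC ler_pdivrMr ?ltr0n//.
have {}H : p <= 2 * a - q by lra.
have := ler_wpM2l (ler0n R n.+3) H.
move: E; rewrite -[n.+4]addn4 -[n.+3]addn3 -[n.+2]addn2 !natrD.
lra.
Qed.

(** Positivity propagates from [cosint2_gt0] by the ratio bound itself; for odd
    powers the integrand changes sign. *)
Lemma cosint_gt0 n : 0 < cosint n.+2 0.
Proof.
elim: n => [|n IH]; first exact: cosint2_gt0.
by apply: lt_le_trans (cosint_ratio n); rewrite mulr_gt0// divr_gt0.
Qed.

End CosineTransform.

Theorem corollary3 (R : realType) (d : nat) (hd : (2 <= d)%N) :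
  d%:R / d.+1%:R <= sigma R d.+1 / sigma R d.
Proof.
case: d hd => [|[|n]]// _.
have c0 : 0 < 2 / pi :> R by rewrite divr_gt0// pi_gt0.
rewrite !sigma_cosint ler_pdivlMr; last by rewrite mulr_gt0// cosint_gt0.
rewrite mulrCA ler_pM2l//; apply: le_trans (cosint_ratio n).
(* cancelling [cosint n.+2 0] leaves [(n+2) (n+4) <= (n+3)^2] *)
rewrite ler_pM2r ?cosint_gt0// ler_pdivrMr ?ltr0n// mulrAC ler_pdivlMr ?ltr0n//.
by rewrite -!natrM ler_nat; lia.
Qed.
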